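(* Let $n\ge1$ and $\pi\in S_n$. Then $\mathrm{weakbump}(\pi)=\mathrm{run}(\pi)$.
   Context: $S_n$ is the set of permutations $\pi=\pi_1\cdots\pi_n$ (one-line notation) of $\{1,\ldots,n\}$. Weakbump: Robinson–Schensted (RS) tableaux are fillings of Young diagrams with distinct positive integers increasing along rows and down columns. To insert $k$ into a tableau $P$ (written $P\leftarrow k$), start with the top row: (I1) if $k$ is greater than or equal to the rightmost entry of the current row, or the current row is empty, append $k$ at the end of that row and stop; (I2) otherwise let $y$ be the leftmost entry of the current row with $k<y$, replace $y$ by $k$ (this is one bump), set $k:=y$, move down one row and go to (I1). For $\pi\in S_n$, let $P_0$ be the empty tableau and $P_i=P_{i-1}\leftarrow\pi_i$ for $1\le i\le n$. Let $\mathrm{bump}_i(\pi)$ be the number of bumps that occur during the insertion $P_{i-1}\leftarrow\pi_i$; let $\mathrm{weakbump}_i(\pi)=1$ if $\mathrm{bump}_i(\pi)>0$ and $0$ otherwise; and $\mathrm{weakbump}(\pi)=\sum_{i=1}^n\mathrm{weakbump}_i(\pi)$. Run: Let $s_i\in S_n$ ($1\le i\le n-1$) be the adjacent transposition exchanging the quantities at positions $i$ and $i+1$. The Coxeter length $\ell(\pi)$ is the minimum number of adjacent transpositions whose product is $\pi$, and a reduced word for $\pi$ is a sequence $[i_1 i_2\cdots i_{\ell(\pi)}]$ with $\pi=s_{i_1}\cdots s_{i_{\ell(\pi)}}$. A run is a (contiguous) increasing or decreasing sequence of consecutive integers in $i_1,i_2,\ldots,i_{\ell(\pi)}$ (i.e.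 of the form $a,a+1,\ldots,b$ or $b,b-1,\ldots,a$ with $a\le b$; a single letter is a run). Then $\mathrm{run}(\pi)$ is the fewest number of runs needed for a reduced word of $\pi$: the minimum, over all reduced words of $\pi$, of the number of runs into which the word can be split by cutting it into contiguous segments (so $\mathrm{run}$ of the identity is $0$). For example, $[21873456]$ is a reduced word of $314569278$ and splits into three runs as $[21.87.3456]$. *)

(* Defs.v *)
From mathcomp Require Import all_boot fingroup perm boolp.

Set Implicit Arguments.
Unset Strict Implicit.
Unset Printing Implicit Defensive.

(* A tableau is the list of its rows, top row first.  [insert P k] is the pair
   of the tableau P <- k and the number of bumps made; running past the last
   row means inserting into an empty row. *)
Fixpoint insert (P : seq (seq nat)) (k : nat) : seq (seq nat) * nat :=
  match P with
  | [::] => ([:: [:: k]], 0)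
  | row :: P' =>
      if nilp row || (last 0 row <= k) then (rcons row k :: P', 0)
      else
        let j := find (fun y => k < y) row in
        let: (Q, b) := insert P' (nth 0 row j) in
        (set_nth 0 row j k :: Q, b.+1)
  end.

(* Positions and values of [pi : 'S_n] live in {0, ..., n-1}; the one-line
   notation below shifts the values back to {1, ..., n}. *)
Definition one_line n (pi : 'S_n) : seq nat := [seq (pi i).+1 | i <- enum 'I_n].

Definition RS_tableau n (pi : 'S_n) (i : nat) : seq (seq nat) :=
  foldl (fun P k => (insert P k).1) [::] (take i (one_line pi)).

(* As [i : 'I_n] counts from 0, it stands for the (i+1)-th insertion
   P_i <- pi_(i+1). *)
Definition bump n (pi : 'S_n) (i : 'I_n) : nat :=
  (insert (RS_tableau pi i) (pi i).+1).2.

Definition weakbump_at n (pi : 'S_n) (i : 'I_n) : nat := 0 < bump pi i.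

Definition weakbump n (pi : 'S_n) : nat := \sum_(i < n) weakbump_at pi i.

(* The letter [i : 'I_n] is the generator s_(i+1) of S_(n+1), which exchanges
   the (0-based) positions i and i+1. *)
Definition adj n (i : 'I_n) : 'S_n.+1 :=
  tperm (widen_ord (leqnSn n) i) (lift ord0 i).

(* s_(i_1) ... s_(i_l) is the composite of functions, in which multiplying by
   s_i on the right exchanges the entries at positions i and i+1 of the
   one-line notation.  MathComp composes permutations in the opposite order,
   (s * t) x = t (s x), hence the [rev]. *)
Definition word_perm n (w : seq 'I_n) : 'S_n.+1 :=
  (\prod_(i <- rev w) adj i)%g.

Lemma word_perm_cat n (v w : seq 'I_n) :
  word_perm (v ++ w) = (word_perm w * word_perm v)%g.
Proof. by rewrite /word_perm rev_cat big_cat. Qed.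

Lemma word_perm_surj n (pi : 'S_n.+1) : exists w : seq 'I_n, word_perm w = pi.
Proof.
have PM (s t : 'S_n.+1) : (exists w, word_perm w = s) ->
    (exists w, word_perm w = t) -> exists w, word_perm w = (s * t)%g.
  by move=> [v <-] [w <-]; exists (w ++ v); rewrite word_perm_cat.
have P1 : exists w : seq 'I_n, word_perm w = 1%g.
  by exists [::]; rewrite /word_perm big_nil.
have Padj (i : 'I_n) : exists w, word_perm w = adj i.
  by exists [:: i]; rewrite /word_perm big_seq1.
have Plt m (x y : 'I_n.+1) : y = x + m :> nat ->
    exists w, word_perm w = tperm x y.
  elim: m y => [|m IHm] y yE.
    by rewrite (_ : y = x) ?tperm1 //; apply/val_inj; rewrite /= yE addn0.
  have ltz : x + m < n by have := ltn_ord y; rewrite yE addnS ltnS.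
  pose i := Ordinal ltz.
  have yi : y = lift ord0 i by apply/val_inj; rewrite /= yE addnS.
  case: m IHm yE ltz @i yi => [|m] IHm yE ltz i yi.
    rewrite (_ : tperm x y = adj i) // /adj -yi; congr (tperm _ _).
    by apply/val_inj; rewrite /= addn0.
  pose z := widen_ord (leqnSn n) i.
  rewrite (_ : tperm x y = adj i * (tperm x z * adj i))%g.
    by apply: (PM) => //; apply: (PM) => //; apply: IHm.
  rewrite -{1}[adj i]tpermV -conjgE /adj -/z -yi tpermJ tpermL tpermD //.
    by rewrite -val_eqE /= gtn_eqF // addnS ltnS leq_addr.
  by rewrite -val_eqE /= yE gtn_eqF // addnS ltnS leq_addr.
have [ts -> _] := prod_tpermP pi; elim/big_ind: _ => //= t _.
have [le_t|lt_t] := leqP t.1 t.2.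
  by apply: (Plt (t.2 - t.1)); rewrite subnKC.
by rewrite tpermC; apply: (Plt (t.1 - t.2)); rewrite subnKC // ltnW.
Qed.

Definition has_word_of_size n (pi : 'S_n.+1) (l : nat) : Prop :=
  exists w : seq 'I_n, word_perm w = pi /\ size w = l.

Lemma has_word n (pi : 'S_n.+1) : exists l, `[< has_word_of_size pi l >].
Proof.
by have [w <-] := word_perm_surj pi; exists (size w); apply/asboolP; exists w.
Qed.

Definition coxeter_length n (pi : 'S_n.+1) : nat := ex_minn (has_word pi).

Definition reduced_word n (pi : 'S_n.+1) (w : seq 'I_n) : Prop :=
  word_perm w = pi /\ size w = coxeter_length pi.

Definition is_run n (s : seq 'I_n) : bool :=
  ~~ nilp s && (sorted (fun i j : 'I_n => j == i.+1 :> nat) s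
                || sorted (fun i j : 'I_n => i == j.+1 :> nat) s).

Definition splits_into_runs n (w : seq 'I_n) (r : nat) : Prop :=
  exists segs : seq (seq 'I_n),
    [/\ flatten segs = w, all (@is_run n) segs & size segs = r].

Definition has_reduced_word_with_runs n (pi : 'S_n.+1) (r : nat) : Prop :=
  exists w : seq 'I_n, reduced_word pi w /\ splits_into_runs w r.

Lemma has_runs n (pi : 'S_n.+1) :
  exists r, `[< has_reduced_word_with_runs pi r >].
Proof.
have [w red_w] : exists w, reduced_word pi w.
  by rewrite /reduced_word /coxeter_length; case: ex_minnP => l /asboolP.
exists (size w); apply/asboolP; exists w; split=> //.
exists [seq [:: i] | i <- w]; split; [|by rewrite all_map; apply/allP|].
  exact: flatten_seq1.
by rewrite size_map.
Qed.

Definition run n (pi : 'S_n.+1) : nat := ex_minn (has_runs pi).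

(* Main.v *)
Require Import Defs.
From mathcomp Require Import all_boot fingroup perm.
From mathcomp Require Import zify.

(** Both statistics equal [n.+1 - L], where [L] is the length of a longest
    increasing subsequence of the one-line notation of [pi].

    For the weak bumps, only the first row of the tableau matters: an insertion
    either bumps or lengthens that row ([first_row_bumps]), and by Schensted's
    theorem the final row has length [L] ([first_row_longest],
    [first_row_attained]).

    For the runs, multiplying by [s_i ... s_j] (or by [s_j ... s_i]) carries
    one entry of the one-line notation to another position and leaves the
    relative order of the others unchanged.  So a word made of [r] runs,
    applied to the identity, spoils an increasing subsequence by at most one
    entry per run ([runs_subseq]): its product has an increasing subsequence
    of length at least [n.+1 - r], hence [n.+1 - L <= r].

    Conversely, fix a longest increasing subsequence.  As long as some entries are
    outside it, one of them can be carried to a place where it joins the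
    subsequence, and it can be chosen so that it only jumps over larger entries
    when going left, or only over smaller entries when going right
    ([leftmost_mover], used for [<] on the sequence and for [>] on its
    reversal).  Every letter of such a run removes an inversion, so after
    [n.+1 - L] runs the identity is reached by a word whose length is the number
    of inversions of [pi]; read backwards, it is a reduced word of [pi]
    ([few_runs], [reduced_word_inv]). *)

(** * First rows and increasing subsequences *)

Definition row_insert (row : seq nat) (k : nat) : seq nat :=
  set_nth 0 row (find (ltn k) row) k.

Definition first_row (s : seq nat) : seq nat := foldl row_insert [::] s.

(** Only the first row decides whether an insertion bumps: the row grows
    exactly when there is no bump. *)
Lemma insert_first_row (P : seq (seq nat)) (k : nat) :
    sorted ltn (head [::] P) ->
  head [::] (insert P k).1 = row_insert (head [::] P) k /\
  (0 < (insert P k).2) = has (ltn k) (head [::] P).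
Proof.
case: P => [|row P] //= srt.
have -> : nilp row || (last 0 row <= k) = ~~ has (ltn k) row.
  case: row srt => [|x row] // srt; rewrite /nilp /= -/(has (ltn k) (x :: row)).
  rewrite -all_predC; apply/idP/allP => [le_k y|/(_ (last x row))]; last first.
    by rewrite mem_last /= -leqNgt; apply.
  rewrite /= -leqNgt => /(nthP 0)[i lti <-]; apply: leq_trans le_k.
  rewrite (last_nth 0).
  apply: (sorted_leq_nth leq_trans leqnn) => //; first exact: (sub_sorted (@ltnW)).
  by rewrite inE.
case: ifPn => [/hasNfind Ek|]; last first.
  by rewrite negbK; case: (insert P _).
split=> //=; last by apply/esym/negbTE; rewrite has_find Ek ltnn.
rewrite /row_insert Ek; elim: row {srt Ek} => //= x row IH; exact/(congr1 (cons x))/IH.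
Qed.

Lemma first_row_rcons s k :
  first_row (rcons s k) = row_insert (first_row s) k.
Proof. exact: foldl_rcons. Qed.

(** Schensted's invariant: the entry of index [j] in the first row is the least
    possible last value of an increasing subsequence of length [j.+1].  It is
    preserved because the new value [k] extends the subsequences ending in an
    entry smaller than [k], hence gives a new minimum exactly at the index
    where [k] is put.  Sortedness of the row identifies that index. *)
Lemma first_row_spec s : uniq s ->
  [/\ sorted ltn (first_row s),
      forall t, subseq t s -> sorted ltn t -> t != [::] ->
        size t <= size (first_row s) /\
        nth 0 (first_row s) (size t).-1 <= last 0 t &
      forall j, j < size (first_row s) -> exists t,
        [/\ subseq t s, sorted ltn t, size t = j.+1
          & last 0 t = nth 0 (first_row s) j] ].
Proof.
elim/last_ind: s => [_|s k IH]; first by split=> // [[]].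
rewrite rcons_uniq => /andP[ks /IH[]]; rewrite first_row_rcons /row_insert.
move: (first_row s) => row srt opt att {IH}.
set j := find (ltn k) row.
have lej : j <= size row by apply: find_size.
have lt_k i : i < j -> nth 0 row i < k.
  move=> lti; have ltis : i < size row by apply: leq_trans lti lej.
  rewrite ltn_neqAle leqNgt; have /= -> := before_find 0 lti; rewrite andbT.
  apply: contraNneq ks => <-; have [t [sub _ st <-]] := att i ltis.
  by apply: (mem_subseq sub); case: (t) st => //= x u _; apply: mem_last.
have k_lt : j < size row -> k < nth 0 row j.
  by rewrite -has_find => /(nth_find 0).
have szE : size (set_nth 0 row j k) = maxn j.+1 (size row) by apply: size_set_nth.
split.
- apply/(sortedP 0) => i; rewrite szE !nth_set_nth /= => lti.
  have inc a b : a < b -> b < size row -> nth 0 row a < nth 0 row b.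
    move=> ltab ltb; apply: (sorted_ltn_nth ltn_trans) => //.
    exact: ltn_trans ltb.
  case: (eqVneq i j) lti => [->|ij] lti.
    rewrite gtn_eqF //; have jr : j.+1 < size row by lia.
    by apply: ltn_trans (k_lt (ltnW jr)) _; apply: inc.
  case: (eqVneq i.+1 j) => [ij1|ij1]; first by apply: lt_k; lia.
  by apply: inc; lia.
- (* The subsequence ends in an old value, or in [k] after an old
     subsequence [t], whose length is then at most [j]. *)
  move=> t; case/lastP: t => // t x sub st _.
  rewrite szE nth_set_nth /= last_rcons size_rcons /=.
  have [xk|xk] := eqVneq x k; last first.
    have subt : subseq (rcons t x) s.
      move: sub; rewrite -subseq_rev !rev_rcons /= (negbTE xk).
      by rewrite -[x :: rev t]rev_rcons subseq_rev.
    have nt : rcons t x != [::] by case: (t).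
    have [] := opt _ subt st nt; rewrite size_rcons last_rcons /= => le1 le2.
    split; first by rewrite leq_max le1 orbT.
    case: eqP le1 le2 => // -> le1 le2.
    by apply: leq_trans le2; apply/ltnW/k_lt.
  subst x.
  have subt : subseq t s.
    by move: sub; rewrite -!cats1 subseq_cat2r.
  have tj : size t <= j.
    case: (t) st subt => // y u st subt.
    have [] := opt _ subt _ isT; first by move: st => /=; rewrite rcons_path => /andP[].
    move: st; rewrite /= rcons_path => /andP[_ lastk] le1 le2.
    rewrite leqNgt; apply/negP; rewrite ltnS => leju.
    have := k_lt (leq_ltn_trans leju le1).
    rewrite ltnNge; apply/negP; rewrite negbK.
    apply: leq_trans (ltnW (leq_ltn_trans le2 lastk)).
    apply: (sorted_leq_nth leq_trans leqnn); rewrite ?inE //.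
    - exact: (sub_sorted (@ltnW)).
    - exact: leq_ltn_trans le1.
  split; first by rewrite leq_max ltnS tj.
  by case: eqP => // /eqP ntj; apply/ltnW/lt_k; rewrite ltn_neqAle ntj.
- move=> i; rewrite szE nth_set_nth /= => lti.
  case: (eqVneq i j) lti => [->|ij] lti.
    case: {-1}j (erefl j) => [|j'] Ej.
      by exists [:: k]; rewrite sub1seq mem_rcons mem_head.
    have [|t [sub st sz la]] := att j'; first by rewrite Ej in lej.
    exists (rcons t k); split; last by rewrite last_rcons.
    - by rewrite -!cats1 cat_subseq.
    - case: (t) sz st la => //= x u _ st la; rewrite rcons_path st la.
      by apply: lt_k; rewrite Ej.
    - by rewrite size_rcons sz.
  have [|t [sub st sz la]] := att i; first by lia.
  by exists t; split=> //; apply: subseq_trans sub (subseq_rcons _ _).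
Qed.

Lemma first_row_longest s t : uniq s -> subseq t s -> sorted ltn t ->
  size t <= size (first_row s).
Proof.
case: t => // x t us sub st; have [_ opt _] := first_row_spec s us.
by have [] := opt _ sub st isT.
Qed.

Lemma first_row_attained s : uniq s ->
  exists t, [/\ subseq t s, sorted ltn t & size t = size (first_row s)].
Proof.
case/first_row_spec => _ _ att; case E: (size (first_row s)) => [|m].
  by exists [::]; rewrite sub0seq.
by have [|t [sub st sz _]] := att m; [rewrite E | exists t].
Qed.

Lemma RS_first_row s : uniq s ->
  head [::] (foldl (fun P k => (insert P k).1) [::] s) = first_row s.
Proof.
elim/last_ind: s => // s k IH; rewrite rcons_uniq => /andP[_ us].
rewrite foldl_rcons first_row_rcons.
have [|-> _] := insert_first_row (foldl (fun P k => (insert P k).1) [::] s) k.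
  by rewrite IH //; case: (first_row_spec s us).
by rewrite IH.
Qed.

Lemma first_row_bumps s : uniq s ->
  size (first_row s) + \sum_(i < size s)
    (0 < (insert (foldl (fun P k => (insert P k).1) [::] (take i s))
                 (nth 0 s i)).2 : nat) = size s.
Proof.
elim/last_ind: s => [|s k IH]; first by rewrite big_ord0.
rewrite rcons_uniq => /andP[_ us].
rewrite size_rcons big_ord_recr /= -cats1 take_size_cat // (nth_cat 0 s) ltnn subnn /=.
rewrite (eq_bigr (fun i : 'I_(size s) =>
    (0 < (insert (foldl (fun P k => (insert P k).1) [::] (take i s))
                 (nth 0 s i)).2 : nat))); last first.
  by move=> i _; rewrite (takel_cat _ (ltnW (ltn_ord i))) nth_cat ltn_ord.
have := IH us; set b := \sum_(_ < _) _ => Eb.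
have [srt _ _] := first_row_spec s us.
have [|_ ->] := insert_first_row (foldl (fun P k => (insert P k).1) [::] s) k.
  by rewrite RS_first_row.
rewrite RS_first_row // cats1 first_row_rcons /row_insert size_set_nth.
have := find_size (ltn k) (first_row s); rewrite has_find.
by case: ltngtP => // [ltf|->] _; rewrite /= -Eb; lia.
Qed.

(** * One-line notation *)

Lemma size_one_line n (pi : 'S_n) : size (one_line pi) = n.
Proof. by rewrite size_map size_enum_ord. Qed.

Lemma nth_one_line n (pi : 'S_n) (i : 'I_n) : nth 0 (one_line pi) i = (pi i).+1.
Proof. by rewrite (nth_map i) ?size_enum_ord // nth_ord_enum. Qed.

Lemma uniq_one_line n (pi : 'S_n) : uniq (one_line pi).
Proof.
by rewrite map_inj_uniq ?enum_uniq // => i j [/val_inj/perm_inj].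
Qed.

Lemma one_line1 n : one_line (1%g : 'S_n) = iota 1 n.
Proof.
rewrite /one_line (eq_map (g := succn \o val)); last by move=> i; rewrite /= perm1.
by rewrite map_comp val_enum_ord -[1]addn0 iotaDl (eq_map add1n).
Qed.

Lemma one_line_perm n (pi : 'S_n) : perm_eq (one_line pi) (iota 1 n).
Proof.
apply: uniq_perm; rewrite ?uniq_one_line ?iota_uniq //.
have [||//] := @uniq_min_size _ (one_line pi) (iota 1 n) (uniq_one_line n pi).
  by move=> x /mapP[i _ ->]; rewrite mem_iota add1n !ltnS /=.
by rewrite size_iota size_one_line.
Qed.

Lemma one_line_inj n : injective (@one_line n).
Proof.
move=> pi rho E; apply/permP => i; apply/val_inj/succn_inj.
by rewrite -!nth_one_line E.
Qed.

Lemma one_line_sorted n (pi : 'S_n) : sorted ltn (one_line pi) -> pi = 1%g.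
Proof.
move=> srt; apply: one_line_inj; rewrite one_line1.
apply: (irr_sorted_eq ltn_trans ltnn) => //; first exact: iota_ltn_sorted.
exact/perm_mem/one_line_perm.
Qed.

Lemma weakbump_first_row n (pi : 'S_n) :
  size (first_row (one_line pi)) + weakbump pi = n.
Proof.
rewrite -[RHS](size_one_line n pi) -(first_row_bumps _ (uniq_one_line n pi)).
congr (_ + _); rewrite size_one_line; apply: eq_bigr => i _.
by rewrite /weakbump_at /bump nth_one_line.
Qed.

(** * Adjacent transpositions acting on sequences *)

Definition swap_at (s : seq nat) (i : nat) : seq nat :=
  take i s ++ nth 0 s i.+1 :: nth 0 s i :: drop i.+2 s.

Lemma swap_at_cat u x y v : swap_at (u ++ x :: y :: v) (size u) = u ++ y :: x :: v.
Proof.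
rewrite /swap_at take_size_cat // !nth_cat ltnn ltnNge leqnSn subnn subSnn /=.
by rewrite -addn2 addnC -drop_drop drop_size_cat //= drop0.
Qed.

Lemma split_at2 (s : seq nat) i : i.+1 < size s ->
  exists u x y v, s = u ++ x :: y :: v /\ size u = i.
Proof.
move=> lti; exists (take i s), (nth 0 s i), (nth 0 s i.+1), (drop i.+2 s).
by rewrite -!drop_nth ?cat_take_drop ?size_takel //; lia.
Qed.

Lemma nth_swap_at s i j : i.+1 < size s ->
  nth 0 (swap_at s i) j =
  nth 0 s (if j == i then i.+1 else if j == i.+1 then i else j).
Proof.
case/split_at2 => u [x [y [v [-> <-]]]]; rewrite swap_at_cat !nth_cat.
case: (ltngtP j (size u)) => [ltj|gtj|->]; last 1 first.
- by rewrite ltnNge leqnSn subnn subSnn.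
- by rewrite ltn_eqF ?ltj // leqW.
case: eqVneq => [->|nj]; first by rewrite ltnn subnn subSnn.
rewrite ltnNge (ltnW gtj) /=.
by case E: (j - size u) => [|[|d]] //; lia.
Qed.

Lemma size_swap_at s i : i.+1 < size s -> size (swap_at s i) = size s.
Proof.
by case/split_at2 => u [x [y [v [-> <-]]]]; rewrite swap_at_cat !size_cat.
Qed.

Lemma one_line_adj n (i : 'I_n) (pi : 'S_n.+1) :
  one_line (adj i * pi)%g = swap_at (one_line pi) i.
Proof.
have lti : i.+1 < size (one_line pi) by rewrite size_one_line ltnS.
apply: (@eq_from_nth _ 0) => [|j]; first by rewrite size_swap_at // !size_one_line.
rewrite size_one_line => ltj; rewrite nth_swap_at //.
rewrite (nth_one_line _ _ (Ordinal ltj)) permM /adj.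
have -> : (if j == i then i.+1 else if j == i.+1 then val i else j) =
    tperm (widen_ord (leqnSn n) i) (lift ord0 i) (Ordinal ltj).
  by case: tpermP => [/(congr1 val)|/(congr1 val)|] /=; rewrite ?bump0 -?val_eqE /=;
    [move=> ->; rewrite eqxx | move=> ->; rewrite eqxx gtn_eqF
    | move=> /eqP + /eqP; rewrite -!val_eqE /= => /negbTE-> /negbTE->].
by rewrite nth_one_line.
Qed.

Lemma word_perm_cons n (i : 'I_n) w :
  word_perm (i :: w) = (word_perm w * adj i)%g.
Proof. by rewrite -cat1s word_perm_cat; congr (_ * _)%g; apply: big_seq1. Qed.

Lemma word_perm_rcons n (i : 'I_n) w :
  word_perm (rcons w i) = (adj i * word_perm w)%g.
Proof. by rewrite -cats1 word_perm_cat; congr (_ * _)%g; apply: big_seq1. Qed.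

Lemma word_perm_nil n : word_perm ([::] : seq 'I_n) = 1%g.
Proof. exact: big_nil. Qed.

Lemma word_permV n (w : seq 'I_n) : (word_perm (rev w) * word_perm w = 1)%g.
Proof.
elim: w => [|i w IH]; first by rewrite word_perm_nil mulg1.
by rewrite rev_cons word_perm_rcons word_perm_cons mulgA -(mulgA (adj i)) IH mulg1 tperm2.
Qed.

Lemma one_line_word n (w : seq 'I_n) (pi : 'S_n.+1) :
  one_line (word_perm w * pi)%g = foldl swap_at (one_line pi) (map val w).
Proof.
elim: w pi => [|i w IH] pi /=; first by rewrite word_perm_nil mul1g.
by rewrite word_perm_cons -mulgA IH one_line_adj.
Qed.

(** * Inversions *)

Fixpoint inv (s : seq nat) : nat :=
  if s is x :: s' then count (gtn x) s' + inv s' else 0.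

Lemma inv_swap u x y v : x < y ->
  inv (u ++ y :: x :: v) = (inv (u ++ x :: y :: v)).+1.
Proof. by move=> xy; elim: u => [|z u IH] /=; rewrite ?IH ?count_cat /=; lia. Qed.

Lemma inv_swap_le u x y v : inv (u ++ y :: x :: v) <= (inv (u ++ x :: y :: v)).+1.
Proof.
have [xy|yx|->] := ltngtP x y; first by rewrite inv_swap.
  by rewrite [X in _ <= X.+1]inv_swap //; lia.
exact: leqnSn.
Qed.

Lemma sorted_inv0 s : sorted ltn s -> inv s = 0.
Proof.
elim: s => //= x s IH srt; rewrite IH ?(path_sorted srt) // addn0.
apply/eqP; rewrite eqn0Ngt -has_count -all_predC.
apply: sub_all (order_path_min ltn_trans srt) => y /=; lia.
Qed.

Lemma inv_word_perm n (w : seq 'I_n) : inv (one_line (word_perm w)) <= size w.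
Proof.
elim/last_ind: w => [|w i IH].
  by rewrite word_perm_nil one_line1 sorted_inv0 // iota_ltn_sorted.
rewrite word_perm_rcons one_line_adj size_rcons.
have : i.+1 < size (one_line (word_perm w)) by rewrite size_one_line ltnS.
case/split_at2 => u [x [y [v [E Ei]]]]; rewrite -{}Ei {}E in IH *.
by rewrite swap_at_cat; apply: leq_trans (inv_swap_le _ _ _ _) _.
Qed.

(** A word as long as the number of inversions is reduced, since a letter
    creates at most one inversion ([inv_word_perm]). *)
Lemma reduced_word_inv n (w : seq 'I_n) (pi : 'S_n.+1) :
  word_perm w = pi -> size w = inv (one_line pi) -> reduced_word pi w.
Proof.
move=> Ew szw; split=> //; rewrite /coxeter_length.
case: ex_minnP => l /boolp.asboolP[w' [Ew' szw']] lmin.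
apply/eqP; rewrite eqn_leq lmin ?andbT; last by apply/boolp.asboolP; exists w.
by rewrite szw -szw' -Ew' inv_word_perm.
Qed.

(** * A run moves a single entry *)

Lemma swaps_right u x m v :
  foldl swap_at (u ++ x :: m ++ v) (iota (size u) (size m)) = u ++ m ++ x :: v.
Proof.
elim: m u => //= y m IH u; rewrite swap_at_cat -!(cat_rcons y u).
by rewrite -(size_rcons u y) IH.
Qed.

Lemma swaps_left u x m v :
  foldl swap_at (u ++ m ++ x :: v) (rev (iota (size u) (size m))) = u ++ x :: m ++ v.
Proof.
elim/last_ind: m v => //= m y IH v.
rewrite size_rcons -addn1 iotaD rev_cat /= cat_rcons.
by rewrite -size_cat catA swap_at_cat -catA IH cat_rcons.
Qed.

Lemma inv_move_right u x m v : all (gtn x) m ->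
  inv (u ++ x :: m ++ v) = inv (u ++ m ++ x :: v) + size m.
Proof.
elim: m u => [|y m IH] u /=; first by rewrite addn0.
case/andP=> yx mx; rewrite inv_swap // -!(cat_rcons y u) IH //; lia.
Qed.

Lemma inv_move_left u x m v : all (ltn x) m ->
  inv (u ++ m ++ x :: v) = inv (u ++ x :: m ++ v) + size m.
Proof.
elim: m u => [|y m IH] u /=; first by rewrite addn0.
case/andP=> xy mx; rewrite -(cat_rcons y u) IH // cat_rcons inv_swap //; lia.
Qed.

Lemma exists_letters n (k : seq nat) : all (gtn n) k ->
  exists w : seq 'I_n, map val w = k.
Proof.
elim: k => [|i k IH] /=; first by exists [::].
by case/andP=> lti /IH[w <-]; exists (Ordinal lti :: w).
Qed.

Lemma is_run_iota n (w : seq 'I_n) i l :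
  map val w = iota i l.+1 -> is_run w /\ is_run (rev w).
Proof.
move=> Ew; have nw : size w = l.+1 by rewrite -(size_map val) Ew size_iota.
rewrite /is_run /nilp size_rev nw !rev_sorted.
have -> : sorted (fun i j : 'I_n => j == i.+1 :> nat) w; last by rewrite orbT.
have := @sorted_map _ _ (@nat_of_ord n) (fun i j => j == i.+1) w => <-.
rewrite Ew /= {Ew nw}.
by elim: l i => //= l IH i; rewrite eqxx IH.
Qed.

(** * Runs are needed *)

Lemma filter_swap_at s i z : i.+1 < size s -> (z == nth 0 s i) || (z == nth 0 s i.+1) ->
  filter (predC1 z) (swap_at s i) = filter (predC1 z) s.
Proof.
case/split_at2 => u [x [y [v [-> <-]]]]; rewrite swap_at_cat !nth_cat !filter_cat.
rewrite ltnn ltnNge leqnSn subnn subSnn /=.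
by case/orP => /eqP->; rewrite eqxx //=; case: eqP.
Qed.

(** Along a run the same entry takes part in every exchange: the positions
    it is carried through are the letters of the run. *)
Lemma run_moves_one n (w : seq 'I_n) s : size s = n.+1 -> is_run w ->
  exists z, filter (predC1 z) (foldl swap_at s (map val w)) = filter (predC1 z) s.
Proof.
case: w => // i w; rewrite /is_run /= => szs /orP[] pw.
- exists (nth 0 s i); elim: w i s szs pw => [|j w IH] i s szs /= => [_|/andP[/eqP ji pw]];
    have lti : i.+1 < size s by [rewrite szs ltnS].
    by rewrite filter_swap_at ?eqxx.
  have := IH j (swap_at s i); rewrite size_swap_at // => /(_ szs pw) /=.
  rewrite nth_swap_at // ji gtn_eqF // eqxx => ->.
  by rewrite filter_swap_at ?eqxx.
- exists (nth 0 s i.+1); elim: w i s szs pw => [|j w IH] i s szs /= => [_|/andP[/eqP ij pw]];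
    have lti : i.+1 < size s by [rewrite szs ltnS].
    by rewrite filter_swap_at ?eqxx ?orbT.
  have := IH j (swap_at s i); rewrite size_swap_at // => /(_ szs pw) /=.
  rewrite -ij nth_swap_at // eqxx => ->.
  by rewrite filter_swap_at ?eqxx ?orbT.
Qed.

(** Removing from the increasing selection [a] the entry moved by a run leaves
    the others in order, so each run costs at most one selected entry. *)
Lemma runs_subseq n (segs : seq (seq 'I_n)) : all (@is_run n) segs ->
  exists a : pred nat, sorted ltn (filter a (one_line (word_perm (flatten segs)))) /\
    count (predC a) (one_line (word_perm (flatten segs))) <= size segs.
Proof.
elim/last_ind: segs => [_|segs w IH].
  exists predT; rewrite /= word_perm_nil one_line1 filter_predT iota_ltn_sorted.
  by rewrite (eq_count (a2 := pred0)) ?count_pred0.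
rewrite all_rcons => /andP[rw /IH[a [srt cnt]]].
rewrite flatten_rcons word_perm_cat one_line_word size_rcons.
set s := one_line _ in srt cnt *; set s' := foldl _ _ _.
have [z Ez] : exists z, filter (predC1 z) s' = filter (predC1 z) s.
  by apply: run_moves_one; rewrite ?size_one_line.
have us' : uniq s' by rewrite /s' -one_line_word uniq_one_line.
have ss' : perm_eq s' s.
  rewrite /s' -one_line_word.
  apply: perm_trans (one_line_perm _ _) _; rewrite perm_sym; exact: one_line_perm.
exists (predD1 a z); split.
  have -> : filter (predD1 a z) s' = filter a (filter (predC1 z) s').
    by rewrite -filter_predI; apply: eq_filter => y /=; rewrite andbC.
  rewrite Ez -filter_predI (eq_filter (a2 := predI (predC1 z) a)); last first.
    by move=> y /=; rewrite andbC.
  by rewrite filter_predI; apply: sorted_filter srt; apply: ltn_trans.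
rewrite (eq_count (a2 := predU (pred1 z) (predC a))); last first.
  by move=> y /=; rewrite negb_and negbK.
have := count_predUI (pred1 z) (predC a) s'.
rewrite (seq.permP ss' (predC a)) count_uniq_mem //; case: (_ \in _) => /=; lia.
Qed.

(** * Sorting with few runs *)

Lemma pairwise_rev (T : Type) (r : rel T) s :
  pairwise r (rev s) = pairwise (fun x y => r y x) s.
Proof.
elim: s => //= x s IH; rewrite rev_cons pairwise_rcons IH; congr (_ && _).
exact: all_rev.
Qed.

(** Let the entries selected by [a] be in [R]-order.  The relation
    [fun y z => a y ==> R y z] fails on a pair exactly when the later entry
    [z] has to travel left past the selected entry [y] in order to join the
    selection.  Take the leftmost such entry [x], and let [l] be the first
    obstacle that it has to pass.  An entry [z] strictly between [l] and [x]
    does not have to travel, so [R l z]; as [R x l] by totality, also [R x z].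
    Hence [x] is on the same side of all the entries [m] that it jumps over. *)
Lemma leftmost_mover (T : eqType) (R : rel T) (a : pred T) (s : seq T) :
    transitive R -> (forall x y, x != y -> R x y || R y x) -> uniq s ->
    pairwise R (filter a s) ->
  pairwise (fun y z => a y ==> R y z) s \/
  exists u m x v, [/\ s = u ++ m ++ x :: v, 0 < size m, ~~ a x, all (R x) m
                    & pairwise R (filter (predU1 x a) (u ++ x :: m ++ v))].
Proof.
set K := fun y z => a y ==> R y z.
move=> Rtr Rtot us srt.
have split_first : pairwise K s \/ exists p x v,
    [/\ s = p ++ x :: v, pairwise K p & ~~ all (K^~ x) p].
  elim/last_ind: s {us srt} => [|s z [Ks|[p [x [v [-> Kp Kx]]]]]]; first by left.
    rewrite pairwise_rcons Ks andbT; case: (boolP (all _ s)) => Kz; first by left.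
    by right; exists s, z, [::]; rewrite cats1.
  by right; exists p, x, (rcons v z); rewrite rcons_cat.
case: split_first => [|[p [x [v [Es Kp]]]]]; [by left | rewrite -has_predC => hasp; right].
case: (split_find hasp) Es Kp => l u m'.
rewrite /= negb_imply => /andP[al NRlx]; rewrite has_predC negbK cat_rcons => Kux Es.
rewrite pairwise_cat => /and3P[_ _ /= /andP[Klm _]].
move: us srt; rewrite {}Es -catA /= => us srt.
have : uniq (x :: (u ++ l :: m') ++ v).
  by move: us; rewrite -cat_cons catA (perm_uniq (permEl (perm_catCA _ [:: x] v))).
rewrite cons_uniq !mem_cat inE !negb_or -!andbA => /and5P[xu xl xm xv _].
have Rxl : R x l by have := Rtot _ _ xl; rewrite (negbTE NRlx) orbF.
have Rlm : all (R l) m' by apply: sub_all Klm => y; rewrite /K al.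
move: srt; rewrite !filter_cat /= al filter_cat /= => srt.
have nax : ~~ a x.
  apply: contra NRlx => ax; move: srt; rewrite ax pairwise_cat => /and3P[_ _] /=.
  by rewrite all_cat /= => /andP[/and3P[_ ->]].
exists u, (l :: m'), x, v; split=> //=.
  by rewrite Rxl; apply: sub_all Rlm => y; apply: Rtr.
have notin t : x \notin t -> filter (predU1 x a) t = filter a t.
  by move=> xt; apply: eq_in_filter => y yt /=; case: eqP => // Ey; rewrite -Ey yt in xt.
move: srt; rewrite !filter_cat /= eqxx al orbT filter_cat /=.
rewrite !notin // (negbTE nax) !pairwise_cat /= => /and3P[cross -> /andP[Rl ->]].
rewrite allrel_consr cross Rl Rxl !andbT /=; apply/andP; split.
  by rewrite all_filter; apply: sub_all Kux => y.
by apply: sub_all Rl => y; apply: Rtr.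
Qed.

(** In this case the selection is enlarged without spending a run: the two
    pairwise conditions say that [x] is already in order with respect to the
    selected entries on its left and on its right. *)
Lemma no_mover a s x : uniq s -> x \in s -> ~~ a x ->
    sorted ltn (filter a s) ->
    pairwise (fun y z => a y ==> (y < z)) s ->
    pairwise (fun y z => a y ==> (z < y)) (rev s) ->
  sorted ltn (filter (predU1 x a) s).
Proof.
move=> us xs nax; rewrite pairwise_rev !(sorted_pairwise ltn_trans).
case/splitPr: xs us => u v.
rewrite (perm_uniq (permEl (perm_catCA _ [:: x] v))) /= mem_cat negb_or.
move=> /andP[/andP[xu xv] _].
have notin t : x \notin t -> filter (predU1 x a) t = filter a t.
  move=> xt; apply: eq_in_filter => y yt /=; case: eqP => // Ey.
  by rewrite -Ey yt in xt.
rewrite !filter_cat /= (negbTE nax) eqxx !notin // !pairwise_cat /=.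
move=> /and3P[cross -> ->] /and3P[+ _ _] /and3P[_ _ /andP[+ _]].
rewrite !allrel_consr cross !all_filter => /andP[-> _] Kv.
by rewrite !andbT; apply: sub_all Kv.
Qed.

Lemma count_unselected (T : eqType) (a : pred T) (x : T) (s : seq T) : ~~ a x -> x \in s ->
  (count (predC (predU1 x a)) s).+1 <= count (predC a) s.
Proof.
rewrite -has_pred1 has_count => nax xs.
have := count_predUI (pred1 x) a s.
rewrite (eq_count (a1 := predI _ _) (a2 := pred0)) ?count_pred0; last first.
  by move=> y /=; case: eqP => // ->; apply: negbTE.
have := count_predC (predU1 x a) s; have := count_predC a s.
change (count (predU (pred1 x) a) s) with (count (predU1 x a) s); lia.
Qed.

(** By induction on [c]: each step enlarges the increasing selection [a] by one
    entry, which is carried to its place by a single run whose letters all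
    remove an inversion.  It goes to the left if [leftmost_mover] provides such
    an entry, otherwise to the right, by the same argument on the reversed
    sequence with the reversed order.  If neither provides one, an entry joins
    in place ([no_mover]); as this is free, the bound is an inequality. *)
Lemma few_runs n c (pi : 'S_n.+1) (a : pred nat) :
    sorted ltn (filter a (one_line pi)) ->
    count (predC a) (one_line pi) <= c ->
  exists segs : seq (seq 'I_n),
    [/\ word_perm (flatten segs) = pi,
        size (flatten segs) = inv (one_line pi),
        all (@is_run n) segs & size segs <= c].
Proof.
elim: c pi a => [|c IH] pi a srt.
  rewrite leqn0 eqn0Ngt -has_count has_predC negbK => /all_filterP Ea.
  exists [::]; move: srt; rewrite Ea => srt; rewrite sorted_inv0 //.
  by split=> //=; rewrite word_perm_nil (one_line_sorted _ pi srt).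
have [lec _|ltc cntc] := leqP (count (predC a) (one_line pi)) c.
  have [segs [E1 E2 E3 E4]] := IH pi a srt lec.
  by exists segs; split=> //; apply: leqW.
have us := uniq_one_line _ pi.
(* Undoing the last run [rev w] of the word leads to the entries [s']. *)
have last_run k l x s' :
    (k = iota l (size k)) \/ (k = rev (iota l (size k))) -> 0 < size k ->
    l + size k <= n -> ~~ a x -> x \in one_line pi ->
    foldl swap_at (one_line pi) k = s' -> inv (one_line pi) = inv s' + size k ->
    sorted ltn (filter (predU1 x a) s') ->
  exists segs : seq (seq 'I_n),
    [/\ word_perm (flatten segs) = pi,
        size (flatten segs) = inv (one_line pi),
        all (@is_run n) segs & size segs <= c.+1].
  move=> Ek k0 len nax xs Es' Einv srt'.
  have [w Ew] : exists w : seq 'I_n, map val w = k.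
    apply: exists_letters; suff : all (gtn n) (iota l (size k)).
      by case: Ek => {2}->; rewrite ?all_rev.
    by apply/allP => i; rewrite mem_iota /=; lia.
  have szw : size w = size k by rewrite -Ew size_map.
  have runw : is_run (rev w).
    have Ek0 : (size k).-1.+1 = size k by apply: prednK.
    case: Ek => Ek; first by case: (is_run_iota n w l (size k).-1); rewrite ?Ek0 ?Ew.
    case: (is_run_iota n (rev w) l (size k).-1) => //.
    by rewrite Ek0 map_rev Ew {1}Ek revK.
  pose rho := (word_perm w * pi)%g.
  have Erho : one_line rho = s' by rewrite one_line_word Ew.
  have srt_rho : sorted ltn (filter (predU1 x a) (one_line rho)) by rewrite Erho.
  have [|segs [E1 E2 E3 E4]] := IH rho (predU1 x a) srt_rho.
    have prho : perm_eq (one_line rho) (one_line pi).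
      apply: perm_trans (one_line_perm _ _) _.
      by rewrite perm_sym; apply: one_line_perm.
    rewrite (seq.permP prho) -ltnS.
    exact: leq_trans (count_unselected _ a x _ nax xs) cntc.
  exists (rcons segs (rev w)); split.
  - rewrite flatten_rcons word_perm_cat E1 /rho mulgA word_permV mul1g //.
  - by rewrite flatten_rcons size_cat E2 size_rev szw Einv Erho.
  - by rewrite all_rcons runw.
  - by rewrite size_rcons.
have size_s := size_one_line _ pi.
have gtn_trans : transitive gtn by move=> y x z /= xy yz; apply: ltn_trans xy.
have ltn_tot x y : x != y -> (x < y) || (y < x) by rewrite neq_ltn.
have gtn_tot x y : x != y -> (y < x) || (x < y) by rewrite neq_ltn orbC.
have srt_pw : pairwise ltn (filter a (one_line pi)).
  by rewrite -(sorted_pairwise ltn_trans).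
have [noL|[u [m [x [v [Es m0 nax xm srt']]]]]] :=
  leftmost_mover _ ltn a _ ltn_trans ltn_tot us srt_pw.
  have us_rev : uniq (rev (one_line pi)) by rewrite rev_uniq.
  have srt_rev : pairwise gtn (filter a (rev (one_line pi))).
    by rewrite filter_rev pairwise_rev.
  have [noR|[u [m [x [v [Es m0 nax xm srt']]]]]] :=
    leftmost_mover _ gtn a _ gtn_trans gtn_tot us_rev srt_rev.
    have /hasP[x xs nax] : has (predC a) (one_line pi) by rewrite has_count; lia.
    have srt' := no_mover a _ x us xs nax srt noL noR.
    have [|segs [E1 E2 E3 E4]] := IH pi (predU1 x a) srt'.
      by rewrite -ltnS; apply: leq_trans (count_unselected _ a x _ nax xs) cntc.
    by exists segs; split=> //; apply: leqW.
  have {}Es : one_line pi = rev v ++ x :: rev m ++ rev u.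
    by rewrite -[LHS]revK Es !rev_cat rev_cons cat_rcons -catA.
  rewrite Es !size_cat /= size_cat in size_s.
  apply: (last_run (iota (size (rev v)) (size (rev m))) (size (rev v)) x
            (rev v ++ rev m ++ x :: rev u)); rewrite ?size_iota //.
  - by left.
  - by rewrite size_rev.
  - by rewrite -ltnS -size_s addnS ltnS addnA leq_addr.
  - by rewrite Es mem_cat mem_head orbT.
  - by rewrite Es swaps_right.
  - by rewrite Es inv_move_right // all_rev.
  rewrite (sorted_pairwise ltn_trans).
  have -> : rev v ++ rev m ++ x :: rev u = rev (u ++ x :: m ++ v).
    by rewrite rev_cat rev_cons rev_cat cat_rcons -catA.
  by rewrite filter_rev pairwise_rev.
rewrite Es !size_cat /= in size_s.
apply: (last_run (rev (iota (size u) (size m))) (size u) x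
          (u ++ x :: m ++ v)); rewrite ?size_rev ?size_iota //.
- by right.
- by rewrite -ltnS -size_s !addnS ltnS addnA leq_addr.
- by rewrite Es !mem_cat mem_head !orbT.
- by rewrite Es swaps_left.
- by rewrite Es inv_move_left.
by rewrite (sorted_pairwise ltn_trans).
Qed.

Theorem proposition20 (n : nat) (pi : 'S_n.+1) : weakbump pi = run pi.
Proof.
have us := uniq_one_line _ pi; have Ewb := weakbump_first_row _ pi.
rewrite /run; case: ex_minnP => r /boolp.asboolP[w [[Ew szw] [segs [Ef runs Er]]]] rmin.
apply/eqP; rewrite eqn_leq; apply/andP; split.
  have [a] := runs_subseq _ segs runs; rewrite Ef Ew Er => -[srt cnt].
  have := first_row_longest _ _ us (filter_subseq a _) srt.
  have := count_predC a (one_line pi); rewrite size_filter size_one_line.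
  move: (count _ _) (count _ _) cnt => i j; lia.
have [t [sub srt szt]] := first_row_attained _ us.
have Et : filter (mem t) (one_line pi) = t by apply/esym/(subseq_uniqP us).
have [||segs' [E1 E2 E3 E4]] := few_runs n (weakbump pi) pi (mem t).
- by rewrite Et.
- rewrite -(leq_add2l (count (mem t) (one_line pi))) count_predC size_one_line.
  by rewrite -size_filter Et szt Ewb.
apply: leq_trans E4; apply: rmin; apply/boolp.asboolP.
exists (flatten segs'); split; first exact: reduced_word_inv.
by exists segs'.
Qed.
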